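(* Let $(S,\mathcal{C})$ and $(S',\mathcal{C}')$ be stratifolds. A continuous map $f:S\to S'$ induces a morphism of stratifolds $(S,\mathcal{C})\to(S',\mathcal{C}')$ if and only if $f$ is $(\mathcal{C},\mathcal{C}')$-admissible.
   Context: A differential space is a pair $(S,\mathcal{C})$ of a topological space $S$ and an $\mathbb{R}$-subalgebra $\mathcal{C}$ of the algebra $C^0(S)$ of continuous real-valued functions on $S$ which is locally detectable ($f\in\mathcal{C}$ if and only if for every $x\in S$ there are an open neighborhood $U$ of $x$ and $g\in\mathcal{C}$ with $f|_U=g|_U$) and $C^\infty$-closed (for all $n\ge 1$, $f_1,\dots,f_n\in\mathcal{C}$ and smooth $g:\mathbb{R}^n\to\mathbb{R}$, the function $x\mapsto g(f_1(x),\dots,f_n(x))$ is in $\mathcal{C}$). A morphism of differential spaces (in particular of stratifolds) $f:(S,\mathcal{C})\to(S',\mathcal{C}')$ is a continuous map $f:S\to S'$ with $\varphi\circ f\in\mathcal{C}$ for all $\varphi\in\mathcal{C}'$. For a subspace $Y\subset S$, $\mathcal{C}_Y\subset C^0(Y)$ is the algebra of locally extendable functions: those $g$ such that each $x\in Y$ has an open neighborhood $V$ in $Y$ and $h\in\mathcal{C}$ with $g|_V=h|_V$; $(Y,\mathcal{C}_Y)$ is a differential space. For $x\in S$, $\mathcal{C}_x$ is the algebra of germs at $x$ of elements of $\mathcal{C}$ and $T_xS$ is the vector space of derivations of $\mathcal{C}_x$ (at $x$, i.e. into $\mathbb{R}$ via evaluation at $x$). A stratifold is a differential space $(S,\mathcal{C})$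 such that: (1) $S$ is locally compact Hausdorff with countable basis; (2) the skeleta $sk_k(S)=\{x\in S\mid \dim T_xS\le k\}$ are closed in $S$; (3) for each $x\in S$ and open neighborhood $U$ of $x$ there is a non-negative $\rho\in\mathcal{C}$ with $\rho(x)\ne0$ and $\mathrm{supp}\,\rho\subset U$; (4) the strata $S^k:=sk_k(S)-sk_{k-1}(S)$ are $k$-dimensional smooth manifolds such that restriction along $S^k\hookrightarrow S$ induces an isomorphism $\mathcal{C}_x\to C^\infty(S^k)_x$ for each $x\in S^k$. All stratifolds are assumed finite-dimensional: $S=sk_n(S)$ for some $n\ge 0$. A local retraction near $x\in S^i$ is a morphism $r_x:(U,\mathcal{C}_U)\to(U\cap S^i,\mathcal{C}_{U\cap S^i})$, $U$ an open neighborhood of $x$ in $S$, with $r_x|_{U\cap S^i}=\mathrm{id}$. A continuous map $f:S\to S'$ is $(\mathcal{C},\mathcal{C}')$-admissible if for any $x\in S$ there exist local retractions $r_x$ near $x$ and $r_{f(x)}$ near $f(x)$ such that $r_{f(x)}\circ f\circ r_x=r_{f(x)}\circ f$ on some neighborhood of $x$, and for each $\phi\in\mathcal{C}'$ the restriction of $\phi\circ f:S\to\mathbb{R}$ to any stratum $S^i$ of $(S,\mathcal{C})$ is smooth. *)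

(* Defs.v *)
From HB Require Import structures.
From mathcomp Require Import all_boot all_order all_algebra.
From mathcomp Require Import all_classical all_reals all_analysis.
Import Order.TTheory GRing.Theory Num.Theory.
Import numFieldNormedType.Exports.

Set Implicit Arguments.
Unset Strict Implicit.
Unset Printing Implicit Defensive.

Local Open Scope classical_set_scope.
Local Open Scope ring_scope.

(* Conventions.
   - A function (or map) on a subspace Y of S is represented by a total function
     on S of which only the values on Y matter; {within Y, continuous _} and
     within Y (nbhs x) are continuity and neighbourhoods in the subspace Y.
   - R^n is 'rV[R]_n, including n = 0 (one point). *)

Section Smooth.
Context {R : realType}.

Definition iter_partial n (s : seq 'I_n) (f : 'rV[R]_n -> R) : 'rV[R]_n -> R :=
  foldr (fun i g x => 'D_(delta_mx ord0 i) g x) f s.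

(* f is infinitely differentiable on U, which is meant to be open: the iterated
   partial derivatives of every order, including f itself, are (Frechet)
   differentiable at every point of U. *)
Definition smooth_on n (U : set 'rV[R]_n) (f : 'rV[R]_n -> R) : Prop :=
  forall (s : seq 'I_n) (x : 'rV[R]_n), U x -> differentiable (iter_partial s f) x.

End Smooth.

Section DifferentialSpaces.
Context {R : realType}.

Definition locally_extendable (S : topologicalType) (C : set (S -> R))
    (Y : set S) : set (S -> R) :=
  [set g | forall x, Y x -> exists V : set S, exists h : S -> R,
    [/\ open_nbhs x V, C h & forall y, Y y -> V y -> g y = h y]].

Record differential_space (S : topologicalType) (C : set (S -> R)) : Prop := {
  ds_continuous : forall f, C f -> continuous f;
  ds_one : C (fun=> 1);
  ds_linear : forall (a : R) f g, C f -> C g -> C (fun x => a * f x + g x);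
  ds_mul : forall f g, C f -> C g -> C (fun x => f x * g x);
  ds_locally_detectable : forall f, C f <-> locally_extendable C [set: S] f;
  ds_smooth_closed : forall (n : nat) (f : 'I_n -> S -> R) (g : 'rV[R]_n -> R),
    (1 <= n)%N -> (forall i, C (f i)) -> smooth_on [set: 'rV[R]_n] g ->
    C (fun x => g (\row_i f i x)) }.

(* r is a morphism from the subspace Y with functions F to the subspace Z with
   functions G. *)
Definition ds_morphism (S S' : topologicalType) (Y : set S) (F : set (S -> R))
    (Z : set S') (G : set (S' -> R)) (r : S -> S') : Prop :=
  [/\ {within Y, continuous r}, set_fun Y Z r &
      forall phi, G phi -> F (phi \o r)].

End DifferentialSpaces.

Section Germs.
Context {R : realType} {S : topologicalType}.

(* The germ at x of f, as an equivalence class in the set F of functions on the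
   subspace Y. *)
Definition germ (F : set (S -> R)) (Y : set S) (x : S) (f : S -> R) :
    set (S -> R) :=
  [set g | F g /\ \forall y \near within Y (nbhs x), g y = f y].

Definition germs (F : set (S -> R)) (Y : set S) (x : S) : set (set (S -> R)) :=
  [set germ F Y x f | f in F].

(* T_x S. The algebra operations on germs are those of representatives; requiring
   the value 0 on sets of functions that are not germs makes this a linear
   subspace of set (S -> R) -> R. *)
Definition tangent_space (C : set (S -> R)) (x : S) : set (set (S -> R) -> R) :=
  [set d | [/\
    forall (a : R) f g, C f -> C g ->
      d (germ C [set: S] x (fun y => a * f y + g y)) =
      a * d (germ C [set: S] x f) + d (germ C [set: S] x g),
    forall f g, C f -> C g ->
      d (germ C [set: S] x (fun y => f y * g y)) =
      f x * d (germ C [set: S] x g) + g x * d (germ C [set: S] x f) &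
    forall G, ~ germs C [set: S] x G -> d G = 0]].

(* The linear subspace E of V has a basis with m elements. *)
Definition has_dim (V : lmodType R) (E : set V) (m : nat) : Prop :=
  exists e : 'I_m -> V, (forall i, E (e i)) /\
    forall v, E v -> exists! a : 'I_m -> R, v = \sum_(i < m) a i *: e i.

Definition skeleton (C : set (S -> R)) (k : nat) : set S :=
  [set x | exists2 m, (m <= k)%N & has_dim (tangent_space C x) m].

(* The (-1)-skeleton is empty. *)
Definition stratum (C : set (S -> R)) (k : nat) : set S :=
  if k is j.+1 then skeleton C k `\` skeleton C j else skeleton C 0.

End Germs.

Section Manifolds.
Context {R : realType} {S : topologicalType}.

Record chart (k : nat) := Chart {
  chart_dom : set S;
  chart_cod : set 'rV[R]_k;
  chart_map : S -> 'rV[R]_k;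
  chart_inv : 'rV[R]_k -> S }.

(* chart_map is a homeomorphism, with inverse chart_inv, from a relatively open
   subset of M onto an open subset of R^k. *)
Record is_chart (M : set S) k (c : chart k) : Prop := {
  chart_dom_open : exists2 O : set S, open O & chart_dom c = M `&` O;
  chart_cod_open : open (chart_cod c);
  chart_mapP : set_fun (chart_dom c) (chart_cod c) (chart_map c);
  chart_invP : set_fun (chart_cod c) (chart_dom c) (chart_inv c);
  chart_mapK : forall x, chart_dom c x -> chart_inv c (chart_map c x) = x;
  chart_invK : forall v, chart_cod c v -> chart_map c (chart_inv c v) = v;
  chart_map_continuous : {within chart_dom c, continuous (chart_map c)};
  chart_inv_continuous : {within chart_cod c, continuous (chart_inv c)} }.

(* A makes the subspace M a k-dimensional smooth manifold. The Hausdorff and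
   countability axioms are not repeated: M is only used inside a Hausdorff,
   second countable S, from which it inherits them. *)
Definition smooth_atlas (M : set S) k (A : set (chart k)) : Prop :=
  [/\ forall c, A c -> is_chart M c,
      forall x, M x -> exists2 c, A c & chart_dom c x &
      forall c c', A c -> A c' -> forall j : 'I_k,
        smooth_on (chart_cod c `&` chart_inv c @^-1` chart_dom c')
          (fun v => chart_map c' (chart_inv c v) ord0 j)].

Definition smooth_fun k (A : set (chart k)) : set (S -> R) :=
  [set g : S -> R | forall c, A c -> smooth_on (chart_cod c) (g \o chart_inv c)].

(* Restriction to M induces an isomorphism from the germs at x of elements of C
   to the germs at x of elements of F, a set of functions on M. *)
Definition restriction_iso (C : set (S -> R)) (M : set S) (F : set (S -> R))
    (x : S) : Prop :=
  [/\ forall f, C f -> F f,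
      forall f g, C f -> C g ->
        germ F M x f = germ F M x g -> germ C [set: S] x f = germ C [set: S] x g &
      forall g, F g -> exists2 f, C f & germ F M x f = germ F M x g].

End Manifolds.
Arguments chart R S k : clear implicits.

(* The smooth structure of the strata is part of the data, but it is determined
   by C: by sf_iso, the smooth functions on a stratum are the functions locally
   extendable to elements of C. *)
Record stratifold (R : realType) (S : topologicalType) := Stratifold {
  sf_fun :> set (S -> R);
  sf_atlas : forall k, set (chart R S k);
  sf_diff : differential_space sf_fun;
  sf_locally_compact : locally_compact [set: S];
  sf_hausdorff : hausdorff_space S;
  sf_countable : @second_countable S;
  sf_skeleton_closed : forall k, closed (skeleton sf_fun k);
  sf_bump : forall (x : S) (U : set S), open_nbhs x U ->
    exists rho : S -> R, [/\ sf_fun rho, forall y, 0 <= rho y, rho x != 0 &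
      closure [set y | rho y != 0] `<=` U];
  sf_manifold : forall k, smooth_atlas (stratum sf_fun k) (@sf_atlas k);
  sf_iso : forall k x, stratum sf_fun k x ->
    restriction_iso sf_fun (stratum sf_fun k) (smooth_fun (@sf_atlas k)) x;
  sf_finite_dim : exists n, skeleton sf_fun n = [set: S] }.
Arguments sf_atlas {R S} _ k _.

Section Admissible.
Context {R : realType}.

Definition local_retraction (S : topologicalType) (C : stratifold R S)
    (i : nat) (x : S) (U : set S) (r : S -> S) : Prop :=
  [/\ stratum C i x, open_nbhs x U,
      ds_morphism U (locally_extendable C U)
        (U `&` stratum C i) (locally_extendable C (U `&` stratum C i)) r &
      forall y, U y -> stratum C i y -> r y = y].

(* In the first clause, W is a neighbourhood of x on which both composites
   are defined. *)
Definition admissible (S S' : topologicalType) (C : stratifold R S)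
    (C' : stratifold R S') (f : S -> S') : Prop :=
  (forall x, exists i U r i' U' r',
    [/\ local_retraction C i x U r, local_retraction C' i' (f x) U' r' &
        exists2 W, open_nbhs x W & forall y, W y ->
          [/\ U y, U' (f y), U' (f (r y)) & r' (f (r y)) = r' (f y)]]) /\
  (forall phi, sf_fun C' phi -> forall i, smooth_fun (sf_atlas C i) (phi \o f)).

End Admissible.

(* Main.v *)
(* In a stratifold an element of C is determined near a point x by its restriction
   to the stratum of x, and every smooth function on the stratum is, near x, the
   restriction of an element of C. So the coordinates of a chart at x extend to
   elements a_1, ..., a_k of C, and the inverse chart applied to (a_1, ..., a_k) is
   a local retraction near x. If f is a morphism, take retractions r and r' of this
   form near x and f(x): the functions a'_j o f and a'_j o f o r agree on the stratum
   of x, hence near x, and r' depends only on the a'_j. Conversely, for phi in C',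
   phi o r' = phi near f(x), so admissibility gives phi o f = (phi o f) o r near x;
   the smooth function phi o f on the stratum extends to some h in C, and h o r is
   locally in C. *)
Require Import Defs.
From mathcomp Require Import all_boot all_order all_algebra.
From mathcomp Require Import all_classical all_reals all_analysis.
From mathcomp Require Import ring lra.
Import Order.TTheory GRing.Theory Num.Theory.
Import numFieldNormedType.Exports.

Set Implicit Arguments.
Unset Strict Implicit.
Unset Printing Implicit Defensive.

Local Open Scope classical_set_scope.
Local Open Scope ring_scope.

(** * Closure properties of smooth functions on open subsets of R^n *)

Section SmoothFunctions.
Context {R : realType}.

(** The first-order expansion of [f] at [x] is also one of [g], and uniqueness of the differential
    identifies its linear part with ['d g x]. *)
Lemma near_eq_differentiable (V W : normedModType R) (f g : V -> W) (x : V) :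
  (\forall y \near x, f y = g y) -> differentiable f x -> differentiable g x.
Proof.
move=> fg /diff_locallyP[cdf fE].
have gE : g \o shift x = cst (g x) + 'd f x +o_ 0 id.
  apply/eqaddoP => e e0; move/eqaddoP: fE => /(_ _ e0); apply: filter_app.
  have : \forall h \near 0, f (h + x) = g (h + x).
    by move: fg; rewrite (near_shift 0) subr0.
  by apply: filter_app; near=> h => /= fgh; rewrite !fctE/= (nbhs_singleton fg) fgh.
by apply/diff_locallyP; rewrite (diff_unique cdf gE).
Unshelve. all: by end_near. Qed.

Lemma derive_comp1 (V : normedModType R) (f : V -> R) (h : R -> R) (x v : V) :
  differentiable f x -> derivable h (f x) 1 ->
  'D_v (h \o f) x = 'D_1 h (f x) * 'D_v f x.
Proof.
move=> fx /derivable1_diffP hx.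
rewrite !deriveE//; last exact: differentiable_comp.
by rewrite diff_comp//= -[X in 'd h _ X]mulr1 [LHS]linearZ mulrC.
Qed.

Section Partials.
Context {n : nat}.
Implicit Types (U : set 'rV[R]_n) (f g : 'rV[R]_n -> R).

Definition partial (i : 'I_n) f : 'rV[R]_n -> R :=
  fun x => 'D_(delta_mx ord0 i) f x.

(** Smoothness up to a finite order, so that closure properties can be proved by induction on the
    order through the rules of differentiation. *)
Fixpoint smooth_upto (N : nat) U f : Prop :=
  (forall x, U x -> differentiable f x) /\
  (if N is N'.+1 then forall i, smooth_upto N' U (partial i f) else True).

(** In [iter_partial] the last index of the list acts first on [f], while [smooth_upto] unfolds the
    first derivative taken; hence lists grow by [rcons]. *)
Lemma smooth_uptoP U f :
  smooth_on U f <-> forall N, smooth_upto N U f.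
Proof.
split=> [fU N|fU s].
  elim: N f fU => [|N IH] f fU; (split; first by move=> x; exact: (fU [::])) => //.
  move=> i; apply: IH => s x Ux.
  by have := fU (rcons s i) x Ux; rewrite /iter_partial foldr_rcons.
move: {fU}(fU (size s)); elim/last_ind: s f => [|s i IH] f.
  by move=> [? _].
rewrite size_rcons => -[_ fU] x Ux.
by rewrite /iter_partial foldr_rcons; exact: IH (fU i) x Ux.
Qed.

Lemma smooth_uptoW N U f : smooth_upto N.+1 U f -> smooth_upto N U f.
Proof.
by elim: N f => [|N IH] f [? Df]; split=> // i; apply: IH; exact: Df.
Qed.

Lemma eq_smooth_upto N U f g : open U -> (forall x, U x -> f x = g x) ->
  smooth_upto N U f -> smooth_upto N U g.
Proof.
move=> oU; elim: N f g => [|N IH] f g fg [fU Df]; split=> //.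
- move=> x Ux; apply: near_eq_differentiable (fU x Ux).
  by near do apply: fg; apply: open_nbhs_nbhs.
- move=> x Ux; apply: near_eq_differentiable (fU x Ux).
  by near do apply: fg; apply: open_nbhs_nbhs.
- move=> i; apply: IH (Df i) => x Ux; apply: near_eq_derive.
  by near do apply: fg; apply: open_nbhs_nbhs.
Unshelve. all: by end_near. Qed.

Lemma smooth_upto_cst N U (c : R) : smooth_upto N U (cst c).
Proof.
elim: N c => [|N IH] c; split=> // i.
suff -> : partial i (cst c) = cst 0 by [].
by apply/funext => x; exact: derive_cst.
Qed.

Lemma smooth_uptoD N U f g : open U ->
  smooth_upto N U f -> smooth_upto N U g -> smooth_upto N U (f + g).
Proof.
move=> oU; elim: N f g => [|N IH] f g [fU Df] [gU Dg]; split=> //.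
- by move=> x Ux; apply: differentiableD; auto.
- by move=> x Ux; apply: differentiableD; auto.
move=> i; apply: eq_smooth_upto (IH _ _ (Df i) (Dg i)) => // x Ux.
by rewrite /partial deriveD//; apply: diff_derivable; auto.
Qed.

(** By the Leibniz rule the derivative is f Dg + g Df, whose factors are all smooth up to one order
    less. *)
Lemma smooth_uptoM N U f g : open U ->
  smooth_upto N U f -> smooth_upto N U g -> smooth_upto N U (f * g).
Proof.
move=> oU; elim: N f g => [|N IH] f g fN gN.
  case: fN gN => [fU _] [gU _]; split=> // x Ux.
  by apply: differentiableM; auto.
have [[fU Df] [gU Dg]] := (fN, gN); split=> [x Ux|i].
  by apply: differentiableM; auto.
have fN' := smooth_uptoW fN; have gN' := smooth_uptoW gN.
apply: eq_smooth_upto (smooth_uptoD oU (IH _ _ fN' (Dg i)) (IH _ _ gN' (Df i))).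
  by [].
by move=> x Ux; rewrite /partial deriveM//; apply: diff_derivable; auto.
Qed.

Lemma smooth_uptoV N U f : open U -> (forall x, U x -> f x != 0) ->
  smooth_upto N U f -> smooth_upto N U (fun x => (f x)^-1).
Proof.
move=> oU f0; elim: N => [|N IH] fN.
  case: fN => [fU _]; split=> // x Ux; apply: differentiableV; auto.
have [fU Df] := fN; split=> [x Ux|i]; first by apply: differentiableV; auto.
have fV := IH (smooth_uptoW fN).
(* The derivative of 1/f is - (1/f) (1/f) Df, and 1/f is covered by induction at the lower order. *)
apply: eq_smooth_upto (smooth_uptoM oU (smooth_uptoM oU (smooth_uptoM oU
  (smooth_upto_cst N U (-1)) fV) fV) (Df i)) => // x Ux.
rewrite /partial deriveV; [|exact: f0|by apply: diff_derivable; auto].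
by rewrite !fctE/= expr2 invfM -[RHS]/(_ * _); ring.
Qed.

Lemma smooth_upto_coord N U i : smooth_upto N U (fun x : 'rV[R]_n => x ord0 i).
Proof.
case: N => [|N]; (split; first by move=> x _; exact: differentiable_coord) => //.
move=> j; suff -> : partial j (fun x => x ord0 i) =
   cst ((delta_mx ord0 j : 'rV[R]_n) ord0 i) by exact: smooth_upto_cst.
apply/funext => x; apply: cvg_lim => //; apply: cvg_near_cst; near=> h.
rewrite /= !mxE addrK -[RHS]mul1r.
rewrite -[LHS]/(_ * _) mulrA mulVf//; near: h; exact: nbhs_dnbhs_neq.
Unshelve. all: by end_near. Qed.

End Partials.
End SmoothFunctions.

(** * The functions t^(-k) exp(-1/t), flat at 0 *)

Section FlatFunctions.
Context {R : realType}.
Implicit Types (k : nat) (t : R).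

(** The power t^(-k) makes the family stable under differentiation, up to linear combinations. *)
Definition flat k t : R := if 0 < t then t^-1 ^+ k * expR (- t^-1) else 0.

Lemma flat_neg k t : t <= 0 -> flat k t = 0.
Proof. by rewrite /flat leNgt => /negbTE ->. Qed.

Lemma flat_ge0 k t : 0 <= flat k t.
Proof.
rewrite /flat; case: ifP => // t0.
by rewrite mulr_ge0 ?expR_ge0// exprn_ge0// invr_ge0 ltW.
Qed.

Lemma flat_gt0 k t : 0 < t -> 0 < flat k t.
Proof. by move=> t0; rewrite /flat t0 mulr_gt0 ?expR_gt0// exprn_gt0// invr_gt0. Qed.

(* With u = 1 / t, this is exp u >= u ^ (k + 2) / (k + 2)!. *)
Lemma flat_le k t : flat k t <= k.+2`!%:R * t ^+ 2.
Proof.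
rewrite /flat; case: ifP => [t0|_]; last by rewrite mulr_ge0// sqr_ge0.
have u0 : 0 < t^-1 by rewrite invr_gt0.
have f0 : 0 < k.+2`!%:R :> R by rewrite ltr0n fact_gt0.
rewrite expRN ler_pdivrMr ?expR_gt0//.
have := expR_ge1Dxn k.+1 (ltW u0); rewrite -[X in _ <= X](mulKf (lt0r_neq0 f0)).
move=> h; have {h} : t^-1 ^+ k.+2 / k.+2`!%:R <= (k.+2`!%:R)^-1 * (k.+2`!%:R * expR t^-1).
  by apply: le_trans h; rewrite lerDr.
rewrite mulrC ler_pM2l ?invr_gt0// => h.
rewrite mulrAC -ler_pdivrMr ?exprn_gt0//; apply: le_trans h.
by rewrite -exprVn -exprD addn2.
Qed.

Lemma is_derive_flat k t :
  is_derive t 1 (flat k) (flat k.+2 t - k%:R * flat k.+1 t).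
Proof.
have [t0|t0|->] := ltgtP t 0.
- rewrite !flat_neg ?ltW// mulr0 subr0.
  apply: near_eq_is_derive (is_derive_cst 0 t 1).
  by near=> s; rewrite flat_neg//; apply: ltW; near: s; exact: lt_nbhsl.
- have tn0 : t != 0 by rewrite gt_eqF.
  have dV : is_derive t 1 (fun s : R => s^-1) (- t ^- 2).
    by apply: is_derive_eq (is_deriveV tn0 (is_derive_id t 1)) _; rewrite scaler1.
  apply: (@near_eq_is_derive _ _ _
      ((fun s => s^-1) ^+ k * (expR \o (fun s : R => - s^-1)))).
    near=> s; rewrite /flat ifT; last by near: s; exact: lt_nbhsr.
    by rewrite !fctE.
  apply: is_derive_eq.
  rewrite /= /flat t0 -![_ *: _]/(_ * _) !fctE/=.
  have -> : t ^- 2 = t^-1 ^+ 2 by rewrite exprVn.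
  case: k => [|k]; rewrite ?exprS; first ring.
  by rewrite /=; ring.
rewrite !flat_neg// mulr0 subr0.
(* At 0 the quadratic bound [flat_le] makes the difference quotient at most (k+2)! |h| in absolute
   value. *)
have h0 : h^-1 *: (flat k (h *: 1 + 0) - flat k 0) @[h --> 0^'] --> (0 : R).
  apply/cvgr0Pnorm_le => e e0; near=> h.
  rewrite (flat_neg k (lexx 0)) subr0 addr0 -[h *: 1]/(h * 1) mulr1 -[_ *: _]/(_ * _).
  have h0 : 0 < `|h| by rewrite normr_gt0; near: h; exact: nbhs_dnbhs_neq.
  have f0 : 0 < k.+2`!%:R :> R by rewrite ltr0n fact_gt0.
  rewrite normrM normfV (ger0_norm (flat_ge0 _ _)) mulrC ler_pdivrMr//.
  apply: le_trans (flat_le k h) _; rewrite -real_normK ?num_real//.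
  rewrite expr2 mulrA ler_pM2r// mulrC -ler_pdivlMr//.
  near: h; apply: dnbhs0_le; exact: divr_gt0.
by apply: DeriveDef; [apply/cvg_ex; exists 0|exact: cvg_lim h0].
Unshelve. all: by end_near. Qed.

End FlatFunctions.

(** * Smooth steps and extension of smooth germs to R^n *)

Section SmoothOn.
Context {R : realType} {n : nat}.
Implicit Types (U : set 'rV[R]_n) (f g : 'rV[R]_n -> R).

(** The chain rule replaces [flat k] by [flat k.+2] and [flat k.+1], so the induction on the order
    is uniform in [k]. *)
Lemma smooth_upto_flat N k U f : open U ->
  smooth_upto N U f -> smooth_upto N U (flat k \o f).
Proof.
move=> oU; elim: N k => [|N IH] k fN.
  case: fN => [fU _]; split=> // x Ux; apply: differentiable_comp; first exact: fU.
  by apply/derivable1_diffP; have [] := is_derive_flat k (f x).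
have [fU Df] := fN; split=> [x Ux|i].
  apply: differentiable_comp; first exact: fU.
  by apply/derivable1_diffP; have [] := is_derive_flat k (f x).
have fN' := smooth_uptoW fN.
apply: eq_smooth_upto (smooth_uptoM oU (smooth_uptoD oU (IH k.+2 fN')
  (smooth_uptoM oU (smooth_upto_cst N U (- k%:R)) (IH k.+1 fN'))) (Df i)) => //.
move=> x Ux; have [dk Dk] := is_derive_flat k (f x).
rewrite /partial derive_comp1//; last exact: fU.
by rewrite Dk !fctE/= mulNr.
Qed.

Lemma smooth_on_local U f :
  (forall x, U x -> exists2 V, open_nbhs x V & smooth_on V f) -> smooth_on U f.
Proof. by move=> fU s x Ux; have [V [_ Vx] fV] := fU x Ux; exact: fV. Qed.

Lemma eq_smooth_on U f g : open U -> (forall x, U x -> f x = g x) ->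
  smooth_on U f -> smooth_on U g.
Proof.
move=> oU fg /smooth_uptoP fU; apply/smooth_uptoP => N.
exact: eq_smooth_upto (fU N).
Qed.

Lemma smooth_on_sub U V f : V `<=` U -> smooth_on U f -> smooth_on V f.
Proof. by move=> VU fU s x /VU; exact: fU. Qed.

Lemma smooth_on_continuous U f x : smooth_on U f -> U x -> {for x, continuous f}.
Proof. by move=> fU Ux; apply/differentiable_continuous/(fU [::]). Qed.

Lemma smooth_on_cst U (c : R) : smooth_on U (fun=> c).
Proof. by apply/smooth_uptoP => N; exact: smooth_upto_cst. Qed.

Lemma smooth_on_coord U i : smooth_on U (fun x : 'rV[R]_n => x ord0 i).
Proof. by apply/smooth_uptoP => N; exact: smooth_upto_coord. Qed.

Lemma smooth_onD U f g : open U ->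
  smooth_on U f -> smooth_on U g -> smooth_on U (fun x => f x + g x).
Proof.
move=> oU /smooth_uptoP fU /smooth_uptoP gU; apply/smooth_uptoP => N.
exact: smooth_uptoD.
Qed.

Lemma smooth_onM U f g : open U ->
  smooth_on U f -> smooth_on U g -> smooth_on U (fun x => f x * g x).
Proof.
move=> oU /smooth_uptoP fU /smooth_uptoP gU; apply/smooth_uptoP => N.
exact: smooth_uptoM.
Qed.

Lemma smooth_onB U f g : open U ->
  smooth_on U f -> smooth_on U g -> smooth_on U (fun x => f x - g x).
Proof.
move=> oU fU gU; apply: (eq_smooth_on oU _ (smooth_onD oU fU
  (smooth_onM oU (smooth_on_cst (-1)) gU))) => x _.
by rewrite mulN1r.
Qed.

Lemma smooth_onV U f : open U -> (forall x, U x -> f x != 0) ->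
  smooth_on U f -> smooth_on U (fun x => (f x)^-1).
Proof.
move=> oU f0 /smooth_uptoP fU; apply/smooth_uptoP => N.
exact: smooth_uptoV.
Qed.

Lemma smooth_on_flat k U f : open U -> smooth_on U f ->
  smooth_on U (fun x => flat k (f x)).
Proof.
move=> oU /smooth_uptoP fU; apply/smooth_uptoP => N.
exact: smooth_upto_flat.
Qed.

Lemma smooth_on_sum U (I : Type) (r : seq I) (F : I -> 'rV[R]_n -> R) : open U ->
  (forall i, smooth_on U (F i)) -> smooth_on U (fun x => \sum_(i <- r) F i x).
Proof.
move=> oU FU; elim: r => [|i r IH].
  by apply: (eq_smooth_on oU _ (smooth_on_cst 0)) => x _; rewrite big_nil.
by apply: (eq_smooth_on oU _ (smooth_onD oU (FU i) IH)) => x _; rewrite big_cons.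
Qed.

(** For a > 0 this is a smooth transition from 0 on t <= 0 to 1 on t >= a; since t > 0 or a - t > 0,
    the denominator never vanishes. *)
Definition step (a t : R) : R := flat 0 t / (flat 0 t + flat 0 (a - t)).

Lemma step_denom_gt0 (a t : R) : 0 < a -> 0 < flat 0 t + flat 0 (a - t).
Proof.
move=> a0; have [t0|t0] := ltP 0 t.
  by rewrite ltr_pwDl ?flat_gt0 ?flat_ge0.
by rewrite ltr_pwDr ?flat_ge0// flat_gt0// subr_gt0 (le_lt_trans t0).
Qed.

Lemma step0 (a t : R) : t <= 0 -> step a t = 0.
Proof. by move=> t0; rewrite /step flat_neg// mul0r. Qed.

Lemma step1 (a t : R) : 0 < a -> a <= t -> step a t = 1.
Proof.
move=> a0 at0; have := step_denom_gt0 t a0; rewrite /step (@flat_neg _ _ (a - t)).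
  by rewrite addr0 => t0; rewrite divff// gt_eqF.
by rewrite subr_le0.
Qed.

Lemma smooth_on_step (a : R) U f : 0 < a -> open U -> smooth_on U f ->
  smooth_on U (fun x => step a (f x)).
Proof.
move=> a0 oU fU; apply: smooth_onM => //; first exact: smooth_on_flat.
apply: smooth_onV => // [x _|]; first by rewrite gt_eqF// step_denom_gt0.
apply: smooth_onD => //; first exact: smooth_on_flat.
by apply: smooth_on_flat => //; apply: smooth_onB => //; exact: smooth_on_cst.
Qed.

(** Multiplying [f] by a smooth cutoff that is 1 near [w] and 0 away from it gives a function smooth
    on all of R^n. *)
Lemma smooth_extension U f (w : 'rV[R]_n) : open U -> U w -> smooth_on U f ->
  exists2 g, smooth_on [set: 'rV[R]_n] g & \forall v \near w, g v = f v.
Proof.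
move=> oU Uw fU.
(* The squared Euclidean distance to [w] is a polynomial, unlike the sup norm that defines the balls
   of ['rV[R]_n]. *)
pose q (v : 'rV[R]_n) := \sum_(i < n) (v ord0 i - w ord0 i) ^+ 2.
have [e e0 qU] : exists2 e, 0 < e & forall v, q v < e -> U v.
  have /nbhs_ballP[/= e e0 eU] : nbhs w U by exact: open_nbhs_nbhs.
  exists (e ^+ 2); first exact: exprn_gt0.
  move=> v qv; apply: eU; split=> // i j; rewrite (ord1 i) /ball/=.
  rewrite distrC -(@ltr_pXn2r _ 2) ?nnegrE ?normr_ge0 ?(ltW e0)//.
  apply: le_lt_trans qv; rewrite real_normK ?num_real// /q (bigD1 j)//= lerDl.
  by apply: sumr_ge0 => k _; exact: sqr_ge0.
have qT : smooth_on setT q.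
  apply: (@smooth_on_sum _ _ _ (fun j v => (v ord0 j - w ord0 j) ^+ 2) openT).
  move=> k.
  have cj := smooth_onB openT (@smooth_on_coord _ k) (@smooth_on_cst _ (w ord0 k)).
  exact: (smooth_onM openT cj cj).
have qc : continuous q by move=> v; exact: smooth_on_continuous qT _.
(* [b] is 1 where q <= e/4 and 0 where q >= e/2. *)
pose b v := step (e / 4) (e / 2 - q v).
have bT V : open V -> smooth_on V b.
  move=> oV; apply: smooth_on_step => //; first by rewrite divr_gt0.
  apply: smooth_onB => //; first exact: smooth_on_cst.
  exact: smooth_on_sub qT.
have oq (A : set R) : open A -> open (q @^-1` A).
  by move=> oA; apply: open_comp => // v _; exact: qc.
exists (fun v => b v * f v).
  (* The open sets q < e, contained in [U], and q > e/2, where the product is 0 whatever the values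
     of [f], cover R^n. *)
  apply: smooth_on_local => v _; have [qe|qe] := ltP (q v) e.
    have oV : open (q @^-1` [set t | t < e]) by apply: oq; exact: open_lt.
    exists (q @^-1` [set t | t < e]) => //.
    apply: smooth_onM => //; first exact: bT.
    by apply: smooth_on_sub fU => y; exact: qU.
  have oV : open (q @^-1` [set t | e / 2 < t]) by apply: oq; exact: open_gt.
  exists (q @^-1` [set t | e / 2 < t]); first by split=> //=; lra.
  apply: (eq_smooth_on oV _ (smooth_on_cst 0)) => y /= qy.
  by rewrite /b step0 ?mul0r// subr_le0 ltW.
have q0 : q w = 0 by rewrite /q big1// => i _; rewrite subrr expr0n.
have : \forall v \near w, q v < e / 4.
  apply: (qc w [set t | t < e / 4]); apply: open_nbhs_nbhs.
  by split; [exact: open_lt|rewrite /= q0 divr_gt0].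
apply: filterS => v qv; rewrite /b step1 ?mul1r ?divr_gt0//; lra.
Qed.

End SmoothOn.

(** * Neighbourhoods, germs and local extensions in differential spaces *)

Lemma continuous_row {R : realType} {S : topologicalType} n (a : 'I_n -> S -> R) :
  (forall i, continuous (a i)) -> continuous (fun x => \row_i a i x : 'rV[R]_n).
Proof.
move=> ac x A [P xP PA].
have : \forall y \near x, forall i, P ord0 i (a i y).
  apply: filter_forall => i; apply: (ac i x).
  by have := xP ord0 i; rewrite mxE.
apply: filterS => y Py; apply: PA => i j; rewrite (ord1 i) mxE; exact: Py.
Qed.

Lemma near_open_nbhs {S : topologicalType} (x : S) (P : set S) :
  (\forall y \near x, P y) -> exists2 V, open_nbhs x V & V `<=` P.
Proof. by rewrite -[X in X -> _]/(nbhs x P) nbhsE. Qed.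

Lemma near_preimage {S S' : topologicalType} (r : S -> S') x y (P : set S') :
  r x = y -> {for x, continuous r} ->
  (\forall z \near y, P z) -> \forall z \near x, P (r z).
Proof. by move=> <- rc; exact: rc. Qed.

Section DifferentialSpaceTheory.
Context {R : realType} {S : topologicalType}.
Implicit Types (C F : set (S -> R)) (f g : S -> R) (x : S).

Lemma ds_cst C (c : R) : differential_space C -> C (fun=> c).
Proof.
move=> dC; have := ds_linear dC (c - 1) (ds_one dC) (ds_one dC).
by rewrite [X in C X](_ : _ = fun=> c)//; apply/funext => x; rewrite mulr1 subrK.
Qed.

(** The closure axiom with the case n = 0, where the composite is constant, added; 0-dimensional
    strata call for it. *)
Lemma ds_smooth_comp C n (a : 'I_n -> S -> R) (g : 'rV[R]_n -> R) :
  differential_space C -> (forall i, C (a i)) -> smooth_on [set: 'rV[R]_n] g ->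
  C (fun x => g (\row_i a i x)).
Proof.
move=> dC Ca gT; case: n a g Ca gT => [|n] a g Ca gT.
  rewrite [X in C X](_ : _ = fun=> g 0); first exact: ds_cst.
  by apply/funext => x; congr g; apply/rowP => -[].
exact: (ds_smooth_closed dC (ltn0Sn n) Ca gT).
Qed.

Lemma ds_local C g : differential_space C ->
  (forall x, exists2 h, C h & \forall y \near x, g y = h y) -> C g.
Proof.
move=> dC gC; apply/(ds_locally_detectable dC) => x _.
have [h Ch /near_open_nbhs[V xV Vh]] := gC x.
by exists V, h; split=> // y _; exact: Vh.
Qed.

Lemma locally_extendable_sub C U g : C g -> locally_extendable C U g.
Proof. by move=> Cg x _; exists setT, g; split=> //; split=> //; exact: openT. Qed.

Lemma locally_extendable_near C U g x : open_nbhs x U ->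
  locally_extendable C U g -> exists2 h, C h & \forall y \near x, g y = h y.
Proof.
move=> xU /(_ _ xU.2)[V [h [xV Ch gh]]]; exists h => //.
near=> y; apply: gh; near: y; exact: open_nbhs_nbhs.
Unshelve. all: by end_near. Qed.

Lemma germ_eqP F Y x f g : F f ->
  (germ F Y x f = germ F Y x g) <-> (\forall y \near x, Y y -> f y = g y).
Proof.
move=> Ff; split=> [fg|fg].
  (* Since [F f], the function [f] belongs to its own germ, hence to that of [g]. *)
  have : germ F Y x f f by split=> //; near=> y.
  by rewrite fg => -[].
apply/seteqP; split=> h [Fh hf]; split=> //; move: hf; rewrite !near_withinE => hf;
  near=> y => Yy.
  by rewrite (near hf y)// (near fg y).
by rewrite (near hf y)// -(near fg y).
Unshelve. all: by end_near. Qed.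

Lemma open_continuous_within (T : topologicalType) (U : set S) (r : S -> T) x :
  open U -> U x -> {within U, continuous r} -> {for x, continuous r}.
Proof.
by move=> oU Ux; rewrite continuous_open_subspace// => /(_ x); apply; rewrite inE.
Qed.

End DifferentialSpaceTheory.

(** * Strata, cutoff functions and local retractions of a stratifold *)

Section StratifoldTheory.
Context {R : realType} {S : topologicalType} (C : stratifold R S).
Implicit Types (f g : S -> R) (x : S) (i k : nat).

Local Notation "''S_' k" := (stratum C k) (at level 8, k at level 2).

(** The index is the least [k] whose skeleton contains [x]; one exists by finite dimensionality. *)
Lemma stratum_exists x : exists k, 'S_k x.
Proof.
have [n nT] := sf_finite_dim C.
have : exists n, `[< skeleton C n x >].
  by exists n; apply/asboolP; rewrite nT.
move=> /ex_minnP[[|k] /asboolP xk mink]; first by exists 0%N.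
by exists k.+1; split=> // /asboolP /mink; rewrite ltnn.
Qed.

(** This is the injectivity half of [sf_iso]. *)
Lemma germ_unique k x f g : 'S_k x -> sf_fun C f -> sf_fun C g ->
  (\forall y \near x, 'S_k y -> f y = g y) -> \forall y \near x, f y = g y.
Proof.
move=> Sx Cf Cg fg; have [CF inj _] := sf_iso Sx.
have fgx : germ C [set: S] x f = germ C [set: S] x g.
  by apply: inj => //; apply/germ_eqP => //; exact: CF.
by have /(_ fgx) := (germ_eqP [set: S] x g Cf).1; apply: filterS => y; apply.
Qed.

(** This is the surjectivity half of [sf_iso]. *)
Lemma stratum_extension k x g : 'S_k x -> smooth_fun (sf_atlas C k) g ->
  exists2 f, sf_fun C f & \forall y \near x, 'S_k y -> f y = g y.
Proof.
move=> Sx gk; have [CF _ ext] := sf_iso Sx; have [f Cf fg] := ext g gk.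
by exists f => //; exact: (germ_eqP _ _ _ (CF _ Cf)).1.
Qed.

Lemma sf_smooth_fun k f : sf_fun C f -> smooth_fun (sf_atlas C k) f.
Proof.
move=> Cf c Ac; have [chartA _ _] := sf_manifold C k; have cC := chartA c Ac.
(* [sf_iso] speaks only at points of the stratum; the point with coordinates [v] supplies one. *)
move=> s v cv; have domc : 'S_k (chart_inv c v).
  have [D _ domE] := chart_dom_open cC.
  by have := chart_invP cC cv; rewrite domE => -[].
by have [CF _ _] := sf_iso domc; exact: CF cv.
Qed.

(** Composing a bump function with a step levels it to 1 near [x]: the result is 0 where rho <=
    rho(x)/3 and 1 where rho >= 2 rho(x)/3. Smooth closure keeps it in [C]. *)
Lemma cutoff x D : open_nbhs x D -> exists s : S -> R,
  [/\ sf_fun C s, \forall y \near x, s y = 1 & closure [set y | s y != 0] `<=` D].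
Proof.
move=> xD; have [rho [Crho rho0 rhox suppD]] := sf_bump C xD.
have a0 : 0 < rho x / 3 by rewrite divr_gt0// lt0r rhox rho0.
have gT : smooth_on [set: 'rV[R]_1]
    (fun v => step (rho x / 3) (v ord0 ord0 - rho x / 3)).
  apply: (smooth_on_step a0 openT).
  exact: smooth_onB openT (@smooth_on_coord _ _ _ _) (smooth_on_cst _).
exists (fun y => step (rho x / 3) (rho y - rho x / 3)); split.
- have := ds_smooth_comp (sf_diff C) (fun=> Crho) gT.
  by under eq_fun do rewrite mxE.
- have : \forall y \near x, rho x / 3 + rho x / 3 < rho y.
    have rhoc := ds_continuous (sf_diff C) Crho (x := x).
    apply: (rhoc [set t | rho x / 3 + rho x / 3 < t]).
    by apply: open_nbhs_nbhs; split; [exact: open_gt|move=> /=; lra].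
  by apply: filterS => y hy; rewrite step1//; lra.
apply: subset_trans suppD; apply: closureS => y /=; apply: contraNN.
by move=> /eqP ->; rewrite step0//; lra.
Qed.

(* The chart coordinates at [x], cut off, are smooth on the whole stratum, hence
   have germs at [x] of elements of [C]. *)
Lemma coordinates_extension k x : 'S_k x -> exists c (a : 'I_k -> S -> R) D,
  [/\ sf_atlas C k c, forall j, sf_fun C (a j), open_nbhs x D &
      forall y, 'S_k y -> D y -> chart_dom c y /\ \row_j a j y = chart_map c y].
Proof.
move=> Sx; have [chartA covA transA] := sf_manifold C k.
have [c Ac xc] := covA x Sx; have cC := chartA c Ac.
have [D oD domE] := chart_dom_open cC.
have xD : open_nbhs x D by split=> //; move: xc; rewrite domE => -[].
have [s [Cs s1 suppD]] := cutoff xD.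
have gA (j : 'I_k) :
    smooth_fun (sf_atlas C k) (fun y => s y * chart_map c y ord0 j).
  move=> c' Ac'; have c'C := chartA c' Ac'.
  have invS v : chart_cod c' v -> 'S_k (chart_inv c' v).
    by move=> /(chart_invP c'C); have [? _ ->] := chart_dom_open c'C => -[].
  have oinv (P : set S) : open P -> open (chart_cod c' `&` chart_inv c' @^-1` P).
    move=> oP; have := chart_inv_continuous c'C.
    rewrite (continuous_open_subspace _ (chart_cod_open c'C)).
    by move=> /(continuous_inP _ (chart_cod_open c'C))/(_ _ oP).
  apply: smooth_on_local => v c'v.
  (* Over [D] the transition map to [c] makes the product smooth; a point outside [D] has a
     neighbourhood missing the support of [s], where the product is 0. *)
  have [vD|vD] := pselect (D (chart_inv c' v)).
    exists (chart_cod c' `&` chart_inv c' @^-1` D); first by split=> //; exact: oinv.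
    pose V := chart_cod c' `&` chart_inv c' @^-1` D.
    have sV : smooth_on V (s \o chart_inv c').
      apply: (smooth_on_sub (U := chart_cod c')) => [w []//|].
      exact: sf_smooth_fun Cs _ Ac'.
    have cV : smooth_on V (fun w => chart_map c (chart_inv c' w) ord0 j).
      apply: smooth_on_sub (transA _ _ Ac' Ac j) => w [c'w wD]; split=> //=.
      by rewrite domE; split=> //; exact: invS.
    exact: smooth_onM (oinv _ oD) sV cV.
  have oK : open (~` closure [set y | s y != 0]).
    by apply: closed_openC; exact: closed_closure.
  exists (chart_cod c' `&` chart_inv c' @^-1` (~` closure [set y | s y != 0])).
    by split; [exact: oinv|split=> //= /suppD].
  apply: (eq_smooth_on (oinv _ oK) _ (smooth_on_cst 0)) => w [c'w /= wK].
  suff -> : s (chart_inv c' w) = 0 by rewrite mul0r.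
  by apply/eqP/negPn/negP => sw; apply: wK; exact: subset_closure.
have /choice[a aP] (j : 'I_k) := (exists2P _ _).1 (stratum_extension Sx (gA j)).
(* Where [s] is 1 the cutoff disappears, so the extensions are the chart coordinates themselves on
   the stratum. *)
have : \forall y \near x, s y = 1 /\ D y /\
    forall j, 'S_k y -> a j y = s y * chart_map c y ord0 j.
  near=> y; split; first by near: y.
  split; first by near: y; exact: open_nbhs_nbhs.
  by near: y; apply: filter_forall => j; have [] := aP j.
move=> /near_open_nbhs[D' xD' D'P].
exists c, a, D'; split=> // [j|y Sy D'y]; first by have [] := aP j.
have [sy [Dy ay]] := D'P y D'y.
split; first by rewrite domE.
by apply/rowP => j; rewrite mxE ay// sy mul1r.
Unshelve. all: by end_near. Qed.

(** The functions [a] are returned with the retraction because equality of their values is the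
    criterion for equality of values of [r]. *)
Lemma local_retraction_exists i x : 'S_i x -> exists U r (a : 'I_i -> S -> R),
  [/\ local_retraction C i x U r, forall j, sf_fun C (a j) &
      forall y z, (forall j, a j y = a j z) -> r y = r z].
Proof.
move=> Sx; have [c [a [D [Ac Ca xD aP]]]] := coordinates_extension Sx.
have [chartA _ _] := sf_manifold C i; have cC := chartA c Ac.
have oc := chart_cod_open cC.
pose av y : 'rV[R]_i := \row_j a j y.
have avc : continuous av.
  by apply: continuous_row => j; exact: (ds_continuous (sf_diff C) (Ca j)).
pose r y := chart_inv c (av y).
have rc y : chart_cod c (av y) -> {for y, continuous r}.
  move=> cy; apply: continuous_comp; first exact: avc.
  exact: open_continuous_within (chart_inv_continuous cC).
have rS y : chart_cod c (av y) -> 'S_i (r y).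
  by move=> /(chart_invP cC); have [? _ ->] := chart_dom_open cC => -[].
have codx y : 'S_i y -> D y -> chart_cod c (av y).
  move=> Sy Dy; have [cy E] := aP y Sy Dy.
  by rewrite /av E; exact: (chart_mapP cC cy).
have rid y : 'S_i y -> D y -> r y = y.
  by move=> Sy Dy; have [cy E] := aP y Sy Dy; rewrite /r /av E (chart_mapK cC).
(* Requiring [r y] in [D] as well makes [U] stable under [r]: then r (r y) = r y, which again lies
   in [D]. *)
pose U := D `&` [set y | chart_cod c (av y) /\ D (r y)].
have xU : open_nbhs x U.
  have xD2 := xD.2; split; last by split=> //=; rewrite rid//; split=> //; exact: codx.
  apply: openI; first exact: xD.1.
  rewrite openE => y [/= cy Dy]; apply: filterI.
    by apply: avc; exact: open_nbhs_nbhs.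
  by apply: rc => //; apply: open_nbhs_nbhs; split=> //; exact: xD.1.
have rU y : U y -> (U `&` 'S_i) (r y).
  move=> [Dy [cy Dry]]; have Sry := rS _ cy.
  by split=> //; split=> //; split; [exact: codx|rewrite rid].
exists U, r, a; split=> //; last first.
  by move=> y z ayz; rewrite /r /av; congr chart_inv; apply/rowP => j; rewrite !mxE.
split=> //; last by move=> y [Dy _] Sy; exact: rid.
split=> // [|phi phiU].
  have [oU _] := xU; rewrite (continuous_open_subspace _ oU) => y.
  by rewrite inE => -[_ [+ _]]; exact: rc.
move=> y Uy; have [_ [cy _]] := Uy.
(* Near [r y], [phi] is the restriction of some [h] in [C]. Read in the chart, [h] is smooth and
   agrees near [av y] with some [G] smooth on R^i, so [phi \o r] is [G \o av] near [y] within
   [U]. *)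
have [V [h [[oV Vy] Ch phih]]] := phiU _ (rU y Uy).
have [G GT Gh] := smooth_extension oc cy (sf_smooth_fun Ch Ac).
have : \forall z \near y, (phi \o r) z = G (av z) \/ ~ U z.
  have Vr := near_preimage erefl (rc y cy) (open_nbhs_nbhs (conj oV Vy)).
  have Gr := near_preimage erefl (@avc y) Gh.
  near=> z; have [Uz|] := pselect (U z); last by right.
  left; rewrite /= (near Gr z)//; have [] := rU z Uz => Ur Sr.
  by apply: phih => //; exact: (near Vr z).
move=> /near_open_nbhs[W yW Wz]; exists W, (G \o av); split=> //.
  exact: ds_smooth_comp (sf_diff C) Ca GT.
by move=> z Uz /Wz[].
Unshelve. all: by end_near. Qed.

End StratifoldTheory.

(** * Morphisms compared with admissible maps *)

Lemma local_retraction_at {R : realType} {S : topologicalType}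
    (C : stratifold R S) i x U r :
  local_retraction C i x U r -> r x = x /\ {for x, continuous r}.
Proof.
move=> [Sx [oU Ux] [rc _ _] rid]; split; first exact: rid.
exact: open_continuous_within rc.
Qed.

Lemma admissible_morphism {R : realType} {S S' : topologicalType}
    (C : stratifold R S) (C' : stratifold R S') (f : S -> S') :
  continuous f -> admissible C C' f -> ds_morphism [set: S] C [set: S'] C' f.
Proof.
move=> fc [fr fs]; split=> // [|phi Cphi]; first exact: continuous_subspaceT.
apply: ds_local (sf_diff C) _ => x.
have [i [U [r [i' [U' [r' [rx rfx [W xW Wr]]]]]]]] := fr x.
have [rxx rc] := local_retraction_at rx.
case: rfx => Sfx xU' [_ _ r'm] r'id; case: rx => Sx xU [_ rS rm] rid.
(* [phi \o r'] is locally in [C'] and agrees with [phi] on the stratum of [f x], which [r'] fixes;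
   uniqueness of germs does the rest. *)
have r'phi : \forall y \near f x, phi (r' y) = phi y.
  have [h' Ch' h'E] := locally_extendable_near xU'
    (r'm phi (locally_extendable_sub Cphi)).
  have : \forall y \near f x, h' y = phi y.
    apply: (germ_unique Sfx) => //; near=> y => Sy.
    rewrite -(near h'E y)//= r'id//; near: y; exact: open_nbhs_nbhs.
  by move: h'E; apply: filterS2 => y /= -> ->.
have [h Ch hE] := stratum_extension Sx (fs phi Cphi i).
have [k Ck kE] := locally_extendable_near xU (rm h (locally_extendable_sub Ch)).
exists k => //.
have rhE := near_preimage rxx rc hE.
have fE := near_preimage erefl (fc x) r'phi.
have rfE := near_preimage rxx rc fE.
near=> y; have [|Uy _ _ E] := Wr y; first by near: y; exact: open_nbhs_nbhs.
(* The chain is k y = h (r y) = phi (f (r y)) = phi (r' (f (r y))) = phi (r' (f y)) = phi (f y). *)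
rewrite -(near kE y)//= (near rhE y)//; last by have [] := rS _ Uy.
by rewrite /= -(near rfE y)// E (near fE y).
Unshelve. all: by end_near. Qed.

Lemma morphism_admissible {R : realType} {S S' : topologicalType}
    (C : stratifold R S) (C' : stratifold R S') (f : S -> S') :
  continuous f -> ds_morphism [set: S] C [set: S'] C' f -> admissible C C' f.
Proof.
move=> fc [_ _ fm]; split=> [x|phi Cphi i]; last exact: sf_smooth_fun (fm _ Cphi).
have [i Sx] := stratum_exists C x; have [i' Sfx] := stratum_exists C' (f x).
have [U [r [_ [rx _ _]]]] := local_retraction_exists Sx.
have [U' [r' [a [r'x Ca r'a]]]] := local_retraction_exists Sfx.
exists i, U, r, i', U', r'; split=> //.
have [rxx rc] := local_retraction_at rx.
case: rx => _ xU [_ _ rm] rid; case: r'x => _ xU' _ _.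
(* Both sides are germs of elements of [C], as [f] and [r] are morphisms, and they agree on the
   stratum of [x], where [r] is the identity. *)
have aE j : \forall y \near x, a j (f (r y)) = a j (f y).
  have Caf : sf_fun C (a j \o f) := fm _ (Ca j).
  have [h Ch hE] := locally_extendable_near xU
    (rm _ (locally_extendable_sub Caf)).
  have : \forall y \near x, h y = a j (f y).
    apply: (germ_unique Sx) => //; near=> y => Sy.
    rewrite -(near hE y)//= rid//; near: y; exact: open_nbhs_nbhs.
  by move: hE; apply: filterS2 => y /= -> ->.
have nU' := open_nbhs_nbhs xU'.
have fU' := near_preimage erefl (fc x) nU'.
have frU' := near_preimage rxx rc fU'.
have : \forall y \near x, [/\ U y, U' (f y), U' (f (r y)) & r' (f (r y)) = r' (f y)].
  near=> y; split; [|exact: (near fU' y)|exact: (near frU' y)|].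
    by near: y; exact: open_nbhs_nbhs.
  (* The index [j] ranges over a finite set, so the equalities [aE] hold simultaneously near [x]. *)
  by apply: r'a; near: y; exact: filter_forall.
by move=> /near_open_nbhs[W xW WP]; exists W.
Unshelve. all: by end_near. Qed.

Theorem proposition5p4 (R : realType) (S S' : topologicalType)
    (C : stratifold R S) (C' : stratifold R S') (f : S -> S')
    (hf : continuous f) :
  ds_morphism [set: S] C [set: S'] C' f <-> admissible C C' f.
Proof. by split; [exact: morphism_admissible|exact: admissible_morphism]. Qed.
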